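(* Let $d\ge1$ and $n\in\mathbb{N}$. The $n$-fold symmetric Kronecker product $S_n(M)$ of a matrix $M\in\mathbb{C}^{d\times d}$ satisfies $S_n(M)^*=S_n(M^* )$. If $M\in\mathrm{GL}(d,\mathbb{C})$, then \[ S_n(M)\in\mathrm{GL}(L_n,\mathbb{C})\quad\text{with}\quad S_n(M)^{-1}=S_n(M^{-1}). \] In particular, if $M\in U(d)$, then $S_n(M)\in U(L_n)$.
   Context: $\mathbb{N}=\{0,1,2,\ldots\}$; $M^*$ is the conjugate transpose; $U(m)$ is the group of unitary $m\times m$ matrices. For $k\in\mathbb{N}^d$, $|k|=k_1+\cdots+k_d$. Let $L_n=\binom{n+d-1}{n}$. Let $\ell_n=(\ell_n(1),\ldots,\ell_n(L_n))$ be the list, without repetition, of all $k\in\mathbb{N}^d$ with $|k|=n$ in reverse (i.e. decreasing) lexicographic order; e.g. for $d=2$, $\ell_2=((2,0),(1,1),(0,2))$. Let $\nu_n=(\nu_n(1),\ldots,\nu_n(d^n))$ be the redundant list defined recursively by $\nu_0=((0,\ldots,0))$ and $\nu_{n+1}((m-1)d^n+j)=\nu_n(j)+e_m^t$ for $m=1,\ldots,d$, $j=1,\ldots,d^n$, where $e_m$ is the $m$th standard basis vector of $\mathbb{C}^d$. For $i\in\{1,\ldots,L_n\}$ let $\sigma_n(i)=\{j\in\{1,\ldots,d^n\}:\nu_n(j)=\ell_n(i)\}$. With $e_1,\ldots,e_{d^n}$ the standard basis of $\mathbb{C}^{d^n}$, let $p_i=\frac{1}{\sqrt{\#\sigma_n(i)}}\sum_{j\in\sigma_n(i)}e_j$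 for $i=1,\ldots,L_n$, and let $P_n$ be the $L_n\times d^n$ matrix with rows $p_1^t,\ldots,p_{L_n}^t$. With $M^{n\otimes}=M\otimes\cdots\otimes M$ ($n$ factors, usual Kronecker product; $M^{0\otimes}=1$), the $n$-fold symmetric Kronecker product of $M$ is $S_n(M)=P_n\,M^{n\otimes}\,P_n^*\in\mathbb{C}^{L_n\times L_n}$. *)

(* Defs.v *)
From HB Require Import structures.
From mathcomp Require Import all_boot all_order all_algebra.
From mathcomp Require mxtens.

Set Implicit Arguments.
Unset Strict Implicit.
Unset Printing Implicit Defensive.

Import Order.TTheory GRing.Theory Num.Theory.
Local Open Scope ring_scope.

Section Indices.
Variable d : nat.

(* Multi-indices k in N^d; tuplelexi carries the lexicographic order. *)
Definition mindex : Type := d.-tuplelexi nat.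
HB.instance Definition _ := Order.Total.on mindex.

Definition mindex0 : mindex := [tuple 0%N | m < d].

Definition add_unit (m : 'I_d) (k : mindex) : mindex :=
  [tuple (tnth k a + (a == m))%N | a < d].

Definition mdeg (k : mindex) : nat := (\sum_(a < d) tnth k a)%N.

Definition Ldim (n : nat) : nat := 'C(n + d - 1, n).

(* If |k| = n then every entry of k is at most n, so it suffices to filter the
   k with entries in {0, .., n}. *)
Definition ell (n : nat) : seq mindex :=
  sort (fun k l => (l <= k)%O)
    [seq k <- [seq (map_tuple val t : mindex) | t : d.-tuple 'I_n.+1]
       | mdeg k == n].

(* nu n.+1 is the concatenation, for m = 0, .., d - 1, of the lists nu n
   shifted by the m-th unit vector. *)
Fixpoint nu (n : nat) : seq mindex :=
  if n is n'.+1 then [seq add_unit m k | m <- enum 'I_d, k <- nu n']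
  else [:: mindex0].

(* For d > 0 all indices are in range (see size_ell and size_nu), so that the
   default value of nth is not used. *)
Definition sigma (n : nat) (i : 'I_(Ldim n)) : {set 'I_(d ^ n)} :=
  [set j : 'I_(d ^ n) | nth mindex0 (nu n) j == nth mindex0 (ell n) i].

Lemma mem_ell n k : (k \in ell n) = (mdeg k == n).
Proof.
rewrite mem_sort mem_filter andb_idr // => /eqP kn.
have lt_k a : (tnth k a < n.+1)%N by rewrite ltnS -kn /mdeg (bigD1 a) ?leq_addr.
apply/mapP; exists [tuple Ordinal (lt_k a) | a < d]; first by rewrite mem_enum.
by apply: eq_from_tnth => a; rewrite tnth_map tnth_mktuple.
Qed.

Lemma val_tuple_inj n : injective (fun t : d.-tuple 'I_n => map_tuple val t).
Proof.
by move=> t u /(congr1 val) /= /inj_map tu; apply: val_inj; apply: tu val_inj.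
Qed.

Lemma ell_uniq n : uniq (ell n).
Proof.
rewrite sort_uniq filter_uniq // map_inj_uniq ?enum_uniq //.
exact: val_tuple_inj.
Qed.

Lemma ell_sorted n : sorted (fun k l => (l < k)%O) (ell n).
Proof.
rewrite -[ell n]revK rev_sorted lt_sorted_uniq_le rev_uniq ell_uniq rev_sorted.
by apply: sort_sorted => k l; apply: le_total.
Qed.

Lemma size_nu n : size (nu n) = (d ^ n)%N.
Proof. by elim: n => //= n IHn; rewrite size_allpairs size_enum_ord IHn expnS. Qed.

End Indices.

Lemma size_ell d n : (0 < d)%N -> size (ell d n) = Ldim d n.
Proof.
case: d => // d _; rewrite size_sort size_filter count_map -size_filter.
rewrite /Ldim addnS subn1 /= addnC -(bin_sub (leq_addl d n)) addnK.
rewrite -card_ord_partitions cardE /enum_mem -!enumT.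
rewrite -filter_predI; congr size; apply: eq_filter => t /=.
rewrite !inE andbT /mdeg big_tuple; congr (_ == _).
by apply: eq_bigr => a _; rewrite tnth_map.
Qed.

Section SymKron.
Variable C : numClosedFieldType.
Variables d n : nat.
Local Open Scope sesquilinear_scope.

Definition pvec (i : 'I_(Ldim d n)) : 'cV[C]_(d ^ n) :=
  (sqrtC (#|sigma i|%:R))^-1 *: \sum_(j in sigma i) delta_mx j 0.

Definition Pmx : 'M[C]_(Ldim d n, d ^ n) :=
  \matrix_(i < Ldim d n) (pvec i)^T.

(* mxtens.ntensmx M n is the n-fold Kronecker power of M, equal to 1 if n = 0;
   A ^t* is the conjugate transpose of A. *)
Definition symkron (M : 'M[C]_d) : 'M[C]_(Ldim d n) :=
  Pmx *m mxtens.ntensmx M n *m Pmx ^t*.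

End SymKron.

Arguments symkron {C d} n M.

(* Main.v *)
From mathcomp Require Import mpoly.
Require Import Defs.
From mathcomp Require Import all_boot all_order all_algebra.
From mathcomp Require Import reals complex.
From mathcomp Require Import mxtens.

Import Order.TTheory GRing.Theory Num.Theory.
Local Open Scope ring_scope.
Local Open Scope complex_scope.
Local Open Scope sesquilinear_scope.

(** Kronecker powers are multiplicative and commute with the adjoint, so
    compatibility of [symkron] with the adjoint is immediate from its form
    [P A P^*], where [P] is [Pmx] and [A] a Kronecker power. Everything else
    follows from two facts: [symkron] maps the identity to the identity, and it
    is multiplicative.

    The first fact says that [P P^* = 1] ([Pmx_unitary]): the rows of [P] are
    normalized indicator vectors of the sets [sigma i], which are disjoint since
    [ell] has no repetition, and nonempty since [nu n] lists every multi-index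
    of degree [n] ([mem_nu]).

    For the second, [P^* P] is the orthogonal projection onto the range of
    [P^*], which is the symmetric subspace: the vectors whose [j]-th coordinate
    depends only on [nu n] at [j] ([Pmx_adj_factor]). It suffices that a
    Kronecker power of a matrix [B] leaves this subspace invariant, for then the
    inner projection in the product of two symmetric powers can be removed.
    Invariance comes from commutativity of polynomials. Substituting the linear
    forms [l_m = sum_a B_(m,a) X_a] for the variables in the monomial indexed by
    [nu n] at [j], and expanding factor by factor, gives the sum over [k] of
    [(B tensor ... tensor B)_(j,k)] times the monomial indexed by [nu n] at [k]
    ([ntensmx_monom]). The left-hand side depends on [j] only through
    [nu n] at [j], hence so does the coefficient of each monomial, which is the
    sum of the [j]-th row over one of the sets [sigma i]
    ([sum_sigma_ntensmx]). *)

Set Implicit Arguments.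
Unset Strict Implicit.
Unset Printing Implicit Defensive.

Section TensorPowers.

Lemma tensmx1 (R : pzRingType) m n :
  1%:M *t 1%:M = 1%:M :> 'M[R]_(m * n).
Proof.
apply/matrixP => i j; case: (mxtens_indexP i) => i1 i2.
case: (mxtens_indexP j) => j1 j2.
rewrite tensmxE !mxE -natrM mulnb -xpair_eqE.
by rewrite (inj_eq (can_inj (@mxtens_indexK m n))).
Qed.

Lemma ntensmx_id (R : pzRingType) d n : ntensmx 1%:M n = 1%:M :> 'M[R]_(d ^ n).
Proof.
case: n => // n; elim: n => // n IHn.
by rewrite ntensmxSS IHn; apply: tensmx1.
Qed.

Lemma ntensmx_mul (R : comPzRingType) d n (A B : 'M[R]_d) :
  ntensmx (A *m B) n = ntensmx A n *m ntensmx B n.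
Proof.
case: n => [|n]; first by rewrite mulmx1.
elim: n => // n IHn.
by rewrite !ntensmxSS IHn -tensmx_mul.
Qed.

Lemma ntensmx_adj (C : numClosedFieldType) d n (A : 'M[C]_d) :
  (ntensmx A n) ^t* = ntensmx (A ^t*) n.
Proof.
case: n => [|n]; first by rewrite trmx1 map_mx1.
elim: n => // n IHn.
by rewrite !ntensmxSS -IHn [X in map_mx _ X]trmx_tens [LHS]map_mxT.
Qed.

End TensorPowers.

Section MultiIndices.
Variable d : nat.

(** The position [m * d ^ n + j] is also the index that the Kronecker product
    gives to the pair [(m, j)]; this links the recursion of [nu] to the one of
    Kronecker powers. *)
Lemma nth_nuS n (m : 'I_d) j : (j < d ^ n)%N ->
  nth (mindex0 d) (nu d n.+1) (m * d ^ n + j) =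
  add_unit m (nth (mindex0 d) (nu d n) j).
Proof.
(* Once [m] is replaced by its place in the enumeration, the claim holds for
   the concatenation along any list of unit vectors. *)
move=> lt_j /=; rewrite -{2}[m](nth_ord_enum m).
have: (m < size (enum 'I_d))%N by rewrite size_enum_ord.
elim: (enum 'I_d) (m : nat) => // a s IHs [|k] lt_k /=;
  rewrite nth_cat size_map size_nu.
  by rewrite lt_j (nth_map (mindex0 d)) ?size_nu.
by rewrite mulSn -addnA ltnNge leq_addr addKn /= IHs.
Qed.

Lemma mdeg_add_unit m (k : mindex d) : mdeg (add_unit m k) = (mdeg k).+1.
Proof.
rewrite /mdeg; under eq_bigr do rewrite tnth_mktuple.
rewrite big_split /= -addn1; congr (_ + _)%N.
by rewrite (bigD1 m) //= eqxx big1 // => a /negPf ->.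
Qed.

Lemma mem_nu n k : (k \in nu d n) = (mdeg k == n).
Proof.
elim: n k => [|n IHn] k.
  rewrite inE /mdeg sum_nat_eq0; apply/eqP/forallP => [-> a | k0].
    by rewrite tnth_mktuple.
  apply: eq_from_tnth => a; rewrite tnth_mktuple.
  exact/eqP/(implyP (k0 a)).
apply/allpairsP/eqP => [[[m l] /= [_ + ->]] | kn].
  by rewrite IHn mdeg_add_unit => /eqP ->.
have /existsP [m k_gt0] : [exists m, (0 < tnth k m)%N].
  rewrite -[X in is_true X]negbK negb_exists; apply/negP => /forallP k0.
  by move: kn; rewrite /mdeg big1 // => a _; apply/eqP; rewrite -leqn0 leqNgt.
(* Lowering a positive entry of [k] gives a predecessor of degree [n]. *)
pose l : mindex d := [tuple (tnth k a - (a == m))%N | a < d].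
have kE : k = add_unit m l.
  apply: eq_from_tnth => a; rewrite !tnth_mktuple subnK //.
  by case: eqP => // ->.
exists (m, l); split; rewrite ?mem_enum //= IHn -eqSS -(mdeg_add_unit m) -kE.
exact/eqP.
Qed.

Lemma sigma_neq0 n (i : 'I_(Ldim d n)) : (0 < d)%N -> sigma i != set0.
Proof.
move=> d_gt0; apply/set0Pn.
have: nth (mindex0 d) (ell d n) i \in nu d n.
  by rewrite mem_nu -mem_ell mem_nth ?size_ell.
case/(nthP (mindex0 d)) => j; rewrite size_nu => lt_j nu_j.
by exists (Ordinal lt_j); rewrite inE nu_j.
Qed.

Lemma ell_index_nu n (j : 'I_(d ^ n)) : (0 < d)%N ->
  exists i : 'I_(Ldim d n),
    nth (mindex0 d) (nu d n) j = nth (mindex0 d) (ell d n) i.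
Proof.
move=> d_gt0; have: nth (mindex0 d) (nu d n) j \in ell d n.
  by rewrite mem_ell -mem_nu mem_nth ?size_nu.
case/(nthP (mindex0 d)) => i; rewrite size_ell // => lt_i <-.
by exists (Ordinal lt_i).
Qed.

Lemma sigma_inj n (i i' : 'I_(Ldim d n)) j : (0 < d)%N ->
  j \in sigma i -> (j \in sigma i') = (i == i').
Proof.
move=> d_gt0; rewrite !inE => /eqP ->.
by rewrite nth_uniq ?size_ell ?ell_uniq.
Qed.

End MultiIndices.

Section Monomials.
Variable d : nat.

Definition monom (S : comPzRingType) (x : 'I_d -> S) (k : mindex d) : S :=
  \prod_(a < d) x a ^+ tnth k a.

Lemma monom0 (S : comPzRingType) (x : 'I_d -> S) : monom x (mindex0 d) = 1.
Proof. by rewrite /monom big1 // => a _; rewrite tnth_mktuple. Qed.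

Lemma monom_add_unit (S : comPzRingType) (x : 'I_d -> S) m k :
  monom x (add_unit m k) = x m * monom x k.
Proof.
rewrite /monom; under eq_bigr do rewrite tnth_mktuple exprD.
rewrite big_split /= mulrC; congr (_ * _).
by rewrite (bigD1 m) //= eqxx big1 ?mulr1 // => a /negPf ->.
Qed.

(** Expanding a product of linear forms over all words of length [n] and
    collecting the result by words: the Kronecker power of [A] is the coefficient
    matrix of the substitution of the linear forms [sum_a A m a *: x a] for the
    [x m]. As [S] is commutative, the right-hand side depends on the word [j]
    only through its multi-index. *)
Lemma ntensmx_monom (R : comPzRingType) (S : comAlgType R) (x : 'I_d -> S)
    n (A : 'M[R]_d) (j : 'I_(d ^ n)) :
  \sum_k ntensmx A n j k *: monom x (nth (mindex0 d) (nu d n) k) =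
  monom (fun m => \sum_a A m a *: x a) (nth (mindex0 d) (nu d n) j).
Proof.
case: n j => [|n] j; first by rewrite big_ord1 !ord1 mxE eqxx scale1r !monom0.
(* The power of exponent 1 is [A] itself and not [A *t 1%:M], so it is a
   separate base case. *)
elim: n j => [|n IHn] j.
  have nu1 (m : 'I_d) : nth (mindex0 d) (nu d 1) m = add_unit m (mindex0 d).
    by have := @nth_nuS d 0 m 0 isT; rewrite addn0 expn0 muln1.
  rewrite nu1 monom_add_unit monom0 mulr1.
  by apply: eq_bigr => k _; rewrite nu1 monom_add_unit monom0 mulr1.
have nuSS (m : 'I_d) (k : 'I_(d ^ n.+1)) :
    nth (mindex0 d) (nu d n.+2) (mxtens_index (m, k)) =
    add_unit m (nth (mindex0 d) (nu d n.+1) k) by rewrite nth_nuS.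
case: (mxtens_indexP j) => m j'; rewrite nuSS monom_add_unit -IHn.
rewrite (reindex (@mxtens_index d (d ^ n.+1))) /=; last first.
  exists (@mxtens_unindex d (d ^ n.+1)) => i _;
    by rewrite (mxtens_indexK, mxtens_unindexK).
rewrite big_distrlr pair_bigA /=; apply: eq_bigr => -[a k] _.
rewrite nuSS monom_add_unit ntensmxSS tensmxE.
by rewrite -scalerAl -scalerAr scalerA.
Qed.

End Monomials.

Section SymKronTheory.
Variables (C : numClosedFieldType) (d n : nat).
Hypothesis d_gt0 : (0 < d)%N.

Local Notation P := (Pmx C d n).
Local Notation nuj j := (nth (mindex0 d) (nu d n) j).
Local Notation elli i := (nth (mindex0 d) (ell d n) i).
Local Notation norm i := (sqrtC (#|sigma i|%:R : C)).

Lemma norm_neq0 (i : 'I_(Ldim d n)) : norm i != 0.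
Proof. by rewrite sqrtC_eq0 pnatr_eq0 cards_eq0 sigma_neq0. Qed.

Lemma PmxE (i : 'I_(Ldim d n)) j : P i j = (norm i)^-1 * (j \in sigma i)%:R.
Proof.
rewrite !mxE summxE; congr (_ * _).
under eq_bigr do rewrite mxE eqxx andbT.
rewrite big_mkcond (bigD1 j) //= eqxx big1 ?addr0; first by case: ifP.
by move=> k /negPf; rewrite eq_sym => ->; case: ifP.
Qed.

(** [Pmx] is real, because the normalizing factors are. *)
Lemma Pmx_adjE (i : 'I_(Ldim d n)) j : (P ^t*) j i = P i j.
Proof.
have -> : (P ^t*) j i = Num.conj (P i j) by rewrite !mxE.
rewrite conj_Creal // PmxE rpredM ?rpred_nat // rpredV.
by rewrite ger0_real // sqrtC_ge0 ler0n.
Qed.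

Lemma Pmx_unitary : P \is unitarymx.
Proof.
apply/unitarymxP/matrixP => i i'; rewrite !mxE.
under eq_bigr do rewrite Pmx_adjE !PmxE mulrACA -natrM mulnb.
rewrite -mulr_sumr -natr_sum; case: eqVneq => [<- | ne_ii'].
  under eq_bigr do rewrite andbb.
  rewrite -big_mkcond sum1_card -invfM -expr2 sqrtCK mulVf //.
  by rewrite -(sqrtCK #|_|%:R) expf_neq0 ?norm_neq0.
rewrite big1 ?mulr0 // => j _.
by case ij: (j \in sigma i); rewrite ?(sigma_inj _ d_gt0 ij) ?(negPf ne_ii').
Qed.

(** The range of the adjoint of [P] consists of all symmetric vectors; on the
    class [sigma i] the value of the vector is recovered from the coordinate [i]
    after undoing the normalization. *)
Lemma Pmx_adj_factor p (V : 'M[C]_(d ^ n, p)) (F : mindex d -> 'I_p -> C) :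
  (forall j q, V j q = F (nuj j) q) -> exists W, V = P ^t* *m W.
Proof.
move=> VE; exists (\matrix_(i, q) (norm i * F (elli i) q)).
apply/matrixP => j q; have [i ji] := ell_index_nu j d_gt0.
have j_i : j \in sigma i by rewrite inE ji.
rewrite mxE (bigD1 i) //= big1 => [|i' /negPf ne_i'i].
  rewrite Pmx_adjE PmxE j_i !mxE mulr1 mulrA mulVf ?norm_neq0 //.
  by rewrite mul1r addr0 VE ji.
by rewrite Pmx_adjE PmxE (sigma_inj _ d_gt0 j_i) eq_sym ne_i'i mulr0 mul0r.
Qed.

Lemma Pmx_adj_mulK p (W : 'M[C]_(Ldim d n, p)) :
  P ^t* *m P *m (P ^t* *m W) = P ^t* *m W.
Proof.
by rewrite -mulmxA [P *m _]mulmxA (unitarymxP Pmx_unitary) mul1mx.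
Qed.

(** Comparison of coefficients in [ntensmx_monom] for polynomial variables. The
    right-hand side shows that the left-hand side depends on [j] only through
    its multi-index, so that Kronecker powers preserve symmetric vectors. *)
Lemma sum_sigma_ntensmx (A : 'M[C]_d) (i : 'I_(Ldim d n)) j :
  \sum_(k in sigma i) ntensmx A n j k =
  (monom (fun m => \sum_a A m a *: ('X_a : {mpoly C[d]})) (nuj j))
    @_(Multinom (elli i)).
Proof.
rewrite -ntensmx_monom raddf_sum big_mkcond /=; apply: eq_bigr => k _.
have -> : monom (fun a => 'X_a : {mpoly C[d]}) (nuj k) = 'X_[Multinom (nuj k)].
  by rewrite mpolyXE_id.
rewrite mcoeffZ mcoeffX inE (inj_eq (can_inj (@mnm_valK d))).
by case: eqP; rewrite (mulr1, mulr0).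
Qed.

(** As the Kronecker power of [B] preserves the range of the adjoint of [P], the
    projection onto it that stands between the two powers acts as the
    identity. *)
Lemma symkron_mul (A B : 'M[C]_d) :
  symkron n (A *m B) = symkron n A *m symkron n B.
Proof.
have [W BW] : exists W, ntensmx B n *m P ^t* = P ^t* *m W.
  apply: (Pmx_adj_factor (F := fun k i => (norm i)^-1 *
    (monom (fun m => \sum_a B m a *: ('X_a : {mpoly C[d]})) k)
      @_(Multinom (elli i)))) => j i.
  rewrite -sum_sigma_ntensmx mxE mulr_sumr [RHS]big_mkcond.
  apply: eq_bigr => k _; rewrite Pmx_adjE PmxE.
  by case: ifP => _; rewrite ?mulr0 // mulr1 mulrC.
rewrite /symkron ntensmx_mul -!mulmxA BW.
by rewrite [P ^t* *m (P *m _)]mulmxA Pmx_adj_mulK.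
Qed.

Lemma symkron_adj (A : 'M[C]_d) : (symkron n A) ^t* = symkron n (A ^t*).
Proof.
by rewrite /symkron !trmx_mul !map_mxM trmxCK ntensmx_adj mulmxA.
Qed.

Lemma symkron1 : symkron n (1%:M : 'M[C]_d) = 1%:M.
Proof. by rewrite /symkron ntensmx_id mulmx1; apply/unitarymxP/Pmx_unitary. Qed.

End SymKronTheory.

Theorem lemma5 (R : realType) (d n : nat) (d_ge1 : (1 <= d)%N) :
  [/\ forall M : 'M[R[i]]_d, (symkron n M) ^t* = symkron n (M ^t*),
      forall M : 'M[R[i]]_d, M \in unitmx ->
        symkron n M \in unitmx /\ invmx (symkron n M) = symkron n (invmx M)
    & forall M : 'M[R[i]]_d, M \is unitarymx -> symkron n M \is unitarymx].
Proof.
split=> M; first exact: symkron_adj.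
  move=> M_unit.
  have SMV : symkron n M *m symkron n (invmx M) = 1%:M.
    by rewrite -symkron_mul // mulmxV ?symkron1.
  have [SM_unit _] := mulmx1_unit SMV.
  by split=> //; rewrite -[LHS]mulmx1 -SMV mulKmx.
move=> /unitarymxP MM; apply/unitarymxP.
by rewrite symkron_adj -symkron_mul // MM symkron1.
Qed.
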